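(* The maps $\mathrm{Chain}$ and $\mathrm{Diag}$ are mutually inverse bijections between Okada half arc-diagrams of rank $N$ and saturated chains $C_0\lessdot C_1\lessdot\dots\lessdot C_N$ of the Young-Fibonacci lattice $\mathbb{YFS}$ that start at the empty Fibonacci set of rank $0$ and terminate at rank level $N$.
   Context: A Fibonacci set of rank $N$ is a subset $S=\{s_1<\dots<s_k\}$ of $[N]=\{1,\dots,N\}$ with $k\equiv N\pmod 2$ and $s_i\equiv i\pmod2$ for all $i$ (the rank is part of the data). $\mathbb{YFS}_N$ is the set of Fibonacci sets of rank $N$ and $\mathbb{YFS}=\bigsqcup_N\mathbb{YFS}_N$. It is a ranked lattice with covering relations $S\lessdot T$, for $S\in\mathbb{YFS}_N$, $T\in\mathbb{YFS}_{N+1}$, whenever $T=S\setminus\{\max S\}$ or $S=T\setminus\{\max T\}$ as sets. Okada half arc-diagram of rank $N$: a partition of $[N]$ into pairs $\{i,j\}$ (full arcs) and singletons $\{i\}$ (propagating half arcs), each carrying an integer label, non-crossing: no two full arcs satisfy $a<c<b<d$, and no propagating half arc at $k$ satisfies $a<k<b$ for a full arc $\{a,b\}$. Nesting: a full arc $\{a<b\}$ is nested in a full arc $\{c<d\}$ if $c<a<b<d$; a full arc $\{a<b\}$ is nested in the half arc at $k$ if $k<a$; the half arc at $i$ is nested in the half arc at $k$ if $k<i$. The label of an arc is at least $1$, at most the smallest node of the arc, and of the same parity as this smallest node; an arc nested in another has a strictly larger label. $\mathrm{PropLab}(H)$ is the set of labels of the propagating half arcs of $H$; it is a Fibonacci set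 of rank $N$. Restriction: for $r\le N$, $H/[r]$ is the Okada half arc-diagram of rank $r$ having a full arc $\{i,j\}$ labelled $\ell$ for every full arc $\{i,j\}$ of $H$ labelled $\ell$ with $i,j\le r$, and a propagating half arc at $i\le r$ labelled $\ell$ whenever $H$ has either a full arc $\{i,j\}$ labelled $\ell$ with $i\le r<j$ or a propagating half arc at $i$ labelled $\ell$. $\mathrm{Chain}(H)=(C_0,\dots,C_N)$ with $C_i=\mathrm{PropLab}(H/[i])$. $\mathrm{Diag}(C_0\lessdot\dots\lessdot C_N)$: start with the empty half arc-diagram and for $i=1,\dots,N$: if $C_i=C_{i-1}\cup\{\ell\}$ with $\ell\notin C_{i-1}$, add a propagating half arc at $i$ labelled $\ell$; if $C_i=C_{i-1}\setminus\{\ell\}$ with $\ell\in C_{i-1}$, replace the propagating half arc labelled $\ell$, at node $j$ say, by the full arc $\{j,i\}$ labelled $\ell$. *)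

(* Defs.v *)
From HB Require Import structures.
From mathcomp Require Import all_boot.
From mathcomp Require Import finmap.

Set Implicit Arguments.
Unset Strict Implicit.
Unset Printing Implicit Defensive.

Local Open Scope fset_scope.

(** * Fibonacci sets and the Young-Fibonacci lattice *)

(* [s] lists S increasingly; its 0-based entry i is s_{i+1}. *)
Definition fibonacci_set (N : nat) (S : {fset nat}) : bool :=
  let s := sort leq S in
  [&& all (fun x => 1 <= x <= N) s,
      size s == N %[mod 2]
    & all (fun i => nth 0 s i == i.+1 %[mod 2]) (iota 0 (size s))].

(* The same set of numbers may have several ranks, so a point of the lattice
   is a pair (rank, set) satisfying [YFS]. *)
Definition ranked_set : Type := (nat * {fset nat})%type.

Definition YFS : pred ranked_set := fun C => fibonacci_set C.1 C.2.

Definition fset_max (S : {fset nat}) : nat := \max_(x <- S) x.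

(* [S] is [T] without its maximum; [T] is required to have one. *)
Definition drops_max (T S : {fset nat}) : bool :=
  (T != fset0) && (S == T `\ fset_max T).

Definition yfs_cover : rel ranked_set := fun C D =>
  [&& YFS C, YFS D, D.1 == C.1.+1 & drops_max C.2 D.2 || drops_max D.2 C.2].

Definition saturated_chain (N : nat) (C : seq ranked_set) : bool :=
  if C is C0 :: C' then
    [&& C0 == (0, fset0), path yfs_cover C0 C' & (last C0 C').1 == N]
  else false.

(** * Okada half arc-diagrams *)

(* [Full a b l] is the full arc {a, b}, where a < b in a diagram, with label l;
   [Half k l] is the propagating half arc at k with label l. *)
Inductive arc : Type :=
  | Full of nat & nat & nat
  | Half of nat & nat.

Definition arc_code (x : arc) : nat * nat * nat + nat * nat :=
  match x with
  | Full a b l => inl (a, b, l)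
  | Half k l => inr (k, l)
  end.

Definition arc_decode (c : nat * nat * nat + nat * nat) : arc :=
  match c with
  | inl (a, b, l) => Full a b l
  | inr (k, l) => Half k l
  end.

Lemma arc_codeK : cancel arc_code arc_decode.
Proof. by case. Qed.

HB.instance Definition _ := Choice.copy arc (can_type arc_codeK).

Definition arc_nodes (x : arc) : seq nat :=
  match x with
  | Full a b _ => [:: a; b]
  | Half k _ => [:: k]
  end.

Definition min_node (x : arc) : nat :=
  match x with
  | Full a b _ => minn a b
  | Half k _ => k
  end.

Definition arc_label (x : arc) : nat :=
  match x with
  | Full _ _ l => l
  | Half _ l => l
  end.

Definition is_half (x : arc) : bool := if x is Half _ _ then true else false.

Definition oriented (x : arc) : bool := if x is Full a b _ then a < b else true.

Definition crossing (x y : arc) : bool :=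
  match x, y with
  | Full a b _, Full c d _ => [&& a < c, c < b & b < d]
  | Half k _, Full a b _ => a < k < b
  | _, Half _ _ => false
  end.

(* [x] is nested in [y]; a half arc contains every arc lying to its right. *)
Definition nested (x y : arc) : bool :=
  match x, y with
  | Full a b _, Full c d _ => [&& c < a, a < b & b < d]
  | Full a _ _, Half k _ => k < a
  | Half i _, Half k _ => k < i
  | Half _ _, Full _ _ _ => false
  end.

Definition good_label (x : arc) : bool :=
  [&& 1 <= arc_label x, arc_label x <= min_node x
    & arc_label x == min_node x %[mod 2]].

Definition diagram : Type := {fset arc}.

(* The [perm_eq] clause says that the arcs partition {1, ..., N}; it also
   forces each block to carry a single label. *)
Definition okada (N : nat) (H : diagram) : Prop :=
  [/\ {in H, forall x, oriented x},
      perm_eq (flatten [seq arc_nodes x | x <- H]) (iota 1 N),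
      {in H &, forall x y, ~~ crossing x y},
      {in H, forall x, good_label x}
    & {in H &, forall x y, nested x y -> arc_label y < arc_label x}].

Definition PropLab (H : diagram) : {fset nat} :=
  [fset arc_label x | x in H & is_half x].

(** * The maps Chain and Diag *)

Definition cut_arc (r : nat) (x : arc) : arc :=
  match x with
  | Full i j l => if j <= r then Full i j l else Half i l
  | Half i l => Half i l
  end.

(* H/[r] *)
Definition restrict (r : nat) (H : diagram) : diagram :=
  [fset cut_arc r x | x in H & min_node x <= r].

Definition Chain (N : nat) (H : diagram) : seq ranked_set :=
  [seq (i, PropLab (restrict i H)) | i <- iota 0 N.+1].

(* Distinct half arcs of a diagram have distinct labels, so at most one arc is
   changed. *)
Definition close_arc (i l : nat) (x : arc) : arc :=
  match x with
  | Half j l' => if l' == l then Full j i l else x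
  | Full _ _ _ => x
  end.

(* Step i of the construction, with A = C_{i-1} and B = C_i; pairs of sets
   matching neither rule leave the diagram unchanged. *)
Definition diag_step (i : nat) (A B : {fset nat}) (H : diagram) : diagram :=
  if [pick l : B | (val l \notin A) && (B == val l |` A)] is Some l then
    Half i (val l) |` H
  else if [pick l : A | B == A `\ val l] is Some l then
    [fset close_arc i (val l) x | x in H]
  else H.

Fixpoint diag_upto (C : seq ranked_set) (i : nat) : diagram :=
  if i is i'.+1 then
    diag_step i (nth (0, fset0) C i').2 (nth (0, fset0) C i).2 (diag_upto C i')
  else fset0.

Definition Diag (N : nat) (C : seq ranked_set) : diagram := diag_upto C N.

(* Main.v *)
Require Import Defs.
From mathcomp Require Import all_boot.
From mathcomp Require Import finmap.
From mathcomp Require Import zify.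

Set Implicit Arguments.
Unset Strict Implicit.
Unset Printing Implicit Defensive.

Local Open Scope fset_scope.

(** Both maps are built one node at a time, so everything reduces to one
    comparison between rank N and rank N+1.

    On diagrams, let H be of rank N+1. If node N+1 carries a half arc, that arc
    lies to the right of all others, so it is nested in every other half arc
    and its label exceeds theirs. If node N+1 closes a full arc {j, N+1},
    then non-crossing forbids half arcs between j and N+1; in H/[N] the arc
    opened at j is therefore the rightmost half arc, hence the one with the
    largest label. Conversely, from a diagram of rank N one may open a half arc
    at N+1 with a larger label of the right parity, or close the half arc with
    the largest label, and the result is a diagram of rank N+1. This one-step
    relation is [grows]; [okada_shrinks] and [okada_grows] are the two
    directions, and [grows_restrict] says that restriction undoes a step.

    On Fibonacci sets, a cover adds a new maximum or removes the maximum. The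
    conditions under which a new maximum l may be added in rank N+1, namely
    1 <= l <= N+1 and l congruent to N+1 modulo 2, are exactly the conditions
    on the label of an arc starting at N+1 ([fibonacci_setU1_max]). Hence
    the covers of (N, PropLab H') are the points (N+1, PropLab H) for the
    diagrams H that grow from H' ([grows_cover], [cover_grows]), and the
    construction step of Diag recovers H from H' and the two sets of labels
    ([grows_diag_step]).

    An induction on N then treats diagrams and chains in parallel: Chain of a
    diagram of rank N+1 is Chain of its restriction with one more point, and
    Diag of a chain is one construction step applied to Diag of the chain
    without its last point. *)

(** * Sets extended by a new maximum *)

Lemma fset_maxE (S : {fset nat}) l :
  l \in S -> {in S, forall x, x <= l} -> fset_max S = l.
Proof.
move=> lS le_l; apply/eqP; rewrite eqn_leq; apply/andP; split.
  by apply/bigmax_leqP_seq => x xS _; exact: le_l.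
exact: (@leq_bigmax_seq _ _ xpredT id l).
Qed.

(** For nonempty sets the value 0 that the empty maximum takes by default does
    no harm: if the maximum is 0, the elements are all 0. *)
Lemma fset_max_in (S : {fset nat}) : S != fset0 -> fset_max S \in S.
Proof.
case/fset0Pn=> y yS; rewrite /fset_max.
have: \max_(x <- S) x \in 0 :: (S : seq nat).
  elim: (S : seq nat) => [|x s IHs]; first by rewrite big_nil inE.
  rewrite big_cons /maxn; case: ifP => _; last by rewrite !inE eqxx orbT.
  by move: IHs; rewrite !inE => /orP[->|->]; rewrite ?orbT.
rewrite inE => /orP[/eqP max0|//].
have: y <= \max_(x <- S) x by exact: (@leq_bigmax_seq _ _ xpredT id y).
by rewrite max0 leqn0 => /eqP <-.
Qed.

Lemma fset_max_ge (S : {fset nat}) x : x \in S -> x <= fset_max S.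
Proof. by move=> xS; exact: (@leq_bigmax_seq _ _ xpredT id x). Qed.

(** Covers are easier to use when they are read upwards, as the adjunction of an
    element above all the others: the maximum is then a variable, not a value
    to be computed. *)
Lemma drops_maxP (T S : {fset nat}) :
  reflect (exists2 l, {in S, forall x, x < l} & T = l |` S) (drops_max T S).
Proof.
apply: (iffP andP) => [[T0 /eqP ->]|[l ltl ->]].
  exists (fset_max T); last by rewrite fsetD1K // fset_max_in.
  move=> x; rewrite !inE => /andP[neq xT].
  by rewrite ltn_neqAle neq fset_max_ge.
have lS : l \notin S by apply/negP => /ltl; rewrite ltnn.
have -> : fset_max (l |` S) = l.
  apply: fset_maxE => [|x]; first by rewrite !inE eqxx.
  by rewrite !inE => /orP[/eqP->//|/ltl /ltnW].
split; first by apply/fset0Pn; exists l; rewrite !inE eqxx.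
by rewrite fsetU1K.
Qed.

Lemma sort_fsetU1_max (S : {fset nat}) l : {in S, forall x, x < l} ->
  sort leq (l |` S) = rcons (sort leq S) l.
Proof.
move=> ltl; have lS : l \notin S by apply/negP => /ltl; rewrite ltnn.
apply: (sorted_eq leq_trans anti_leq).
- exact: (sort_sorted leq_total).
- rewrite -cats1 (sorted_pairwise leq_trans) pairwise_cat /=.
  rewrite -(sorted_pairwise leq_trans) (sort_sorted leq_total) !andbT.
  by apply/allrelP => x y; rewrite mem_sort inE => /ltl xl /eqP ->; exact: ltnW.
- rewrite perm_sort perm_sym perm_rcons.
  apply: uniq_perm; rewrite /= ?sort_uniq ?fset_uniq ?mem_sort ?lS //.
  by move=> x; rewrite !inE mem_sort.
Qed.

(** A new maximum comes last in increasing order, at position |S| + 1, so its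
    parity condition compares it with |S| + 1, which is congruent to N + 1.
    The bound by N on the elements of S is recovered from l <= N+1 since they
    are smaller than l. *)
Lemma fibonacci_setU1_max N (S : {fset nat}) l : {in S, forall x, x < l} ->
  fibonacci_set N.+1 (l |` S) =
  [&& fibonacci_set N S, l <= N.+1, 0 < l & l == N.+1 %[mod 2]].
Proof.
move=> ltl; rewrite /fibonacci_set sort_fsetU1_max //; set s := sort leq S.
have mem_s x : (x \in s) = (x \in S) by rewrite mem_sort.
rewrite size_rcons all_rcons -[X in iota _ X]addn1 iotaD all_cat add0n /=.
rewrite nth_rcons ltnn eqxx.
rewrite andbT.
have -> : all (fun i => nth 0 (rcons s l) i == i.+1 %[mod 2]) (iota 0 (size s))
        = all (fun i => nth 0 s i == i.+1 %[mod 2]) (iota 0 (size s)).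
  by apply: eq_in_all => i; rewrite mem_iota /= add0n nth_rcons => ->.
case: (all (fun i => nth 0 s i == i.+1 %[mod 2]) _); last by rewrite !andbF.
have -> : ((size s).+1 == N.+1 %[mod 2]) = (size s == N %[mod 2]).
  by rewrite -addn1 -[N.+1]addn1 eqn_modDr.
rewrite !andbT /=; case sN: (size s == N %[mod 2]); last by rewrite !andbF.
have -> : (l == (size s).+1 %[mod 2]) = (l == N.+1 %[mod 2]).
  by move/eqP: sN => sN; rewrite -[N.+1]addn1 -modnDml -sN modnDml addn1.
case: (l == N.+1 %[mod 2]); last by rewrite !andbF.
rewrite !andbT; case: (ltnP 0 l) => l0; last by rewrite !andbF.
case: (leqP l N.+1) => lN; last by rewrite !andbF.
rewrite !andbT /=; apply: eq_in_all => x; rewrite mem_s => /ltl xl.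
by congr (_ && _); lia.
Qed.

Lemma fibonacci_setSS N (S : {fset nat}) :
  fibonacci_set N S -> fibonacci_set N.+2 S.
Proof.
case/and3P=> /allP s1 s2 s3; apply/and3P; split=> //.
by apply/allP => x /s1; lia.
Qed.

(** Removing the maximum undoes the previous step and so lands in rank N-1;
    the rank can then be raised by 2, which changes no parity. *)
Lemma fibonacci_setU1_drop N (S : {fset nat}) l : {in S, forall x, x < l} ->
  fibonacci_set N (l |` S) -> fibonacci_set N.+1 S.
Proof.
move=> ltl; case: N => [/and3P[/allP s1 _ _]|N].
  by have := s1 l; rewrite mem_sort !inE eqxx /=; lia.
by rewrite fibonacci_setU1_max // => /and4P[/fibonacci_setSS].
Qed.

(** * Counting the arcs through a node *)

(** The partition clause of a diagram, a permutation of lists, becomes an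
    additive condition on each node, which is easy to follow when one arc is
    added, removed or replaced. *)
Definition degree (H : diagram) (k : nat) : nat :=
  \sum_(x <- H) count_mem k (arc_nodes x).

Lemma degree_partP N (H : diagram) :
  reflect (forall k, degree H k = (0 < k <= N))
    (perm_eq (flatten [seq arc_nodes x | x <- H]) (iota 1 N)).
Proof.
have degE k : count_mem k (flatten [seq arc_nodes x | x <- H]) = degree H k.
  by rewrite count_flatten sumnE !big_map.
have iotaE k : count_mem k (iota 1 N) = (0 < k <= N).
  by rewrite count_uniq_mem ?iota_uniq // mem_iota add1n ltnS.
apply: (iffP idP) => [/permP pe k|pe]; first by rewrite -degE pe iotaE.
by apply/allP => k _ /=; rewrite degE iotaE pe.
Qed.

Lemma degreeU1 (x : Defs.arc) (H : diagram) k : x \notin H ->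
  degree (x |` H) k = (count_mem k (arc_nodes x) + degree H k)%N.
Proof. by move=> xH; rewrite /degree big_fsetU1. Qed.

Lemma degree_gt0 (x : Defs.arc) (H : diagram) k :
  x \in H -> k \in arc_nodes x -> 0 < degree H k.
Proof.
move=> xH kx; rewrite /degree (big_fsetD1 x) //=.
by rewrite addn_gt0 -has_count has_pred1 kx.
Qed.

Lemma degree_arc (H : diagram) k :
  0 < degree H k -> exists2 x, x \in H & k \in arc_nodes x.
Proof.
rewrite lt0n sum_nat_seq_neq0 => /hasP[x xH] /=.
by rewrite -lt0n -has_count has_pred1; exists x.
Qed.

Lemma okada_nodes N H (x : Defs.arc) (k : nat) :
  okada N H -> x \in H -> k \in arc_nodes x ->
  0 < k <= N.
Proof.
case=> _ /degree_partP dH _ _ _ xH kx.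
by have := degree_gt0 xH kx; rewrite dH lt0b.
Qed.

(** * Growing a diagram by one node *)

Definition halves_below (l : nat) (H : diagram) : Prop :=
  forall k m, Half k m \in H -> m < l.

(** One construction step seen on diagrams. In both cases H0 is the part common
    to the two diagrams; in the second the condition on labels makes the half
    arc that is closed the one with the largest label. *)
Inductive grows (N : nat) : diagram -> diagram -> Prop :=
  | GrowsOpen l (H0 : diagram) of
      halves_below l H0 & good_label (Half N.+1 l) :
      grows N H0 (Half N.+1 l |` H0)
  | GrowsClose j l (H0 : diagram) of
      halves_below l H0 :
      grows N (Half j l |` H0) (Full j N.+1 l |` H0).

Lemma halves_below_notin j l H : halves_below l H -> Half j l \notin H.
Proof. by move=> lH; apply/negP => /lH; rewrite ltnn. Qed.

Lemma in_fsetU1P (x y : Defs.arc) (H : diagram) :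
  reflect (x = y \/ x \in H) (x \in y |` H).
Proof. by rewrite in_fset1U; apply: predU1P. Qed.

(** The arc x through node N+1 determines the step, and all other arcs have
    their nodes in [1, N]. The other half arcs have labels below that of
    x because x is nested in each of them: they start to the left of x, and
    when x is a full arc {j, N+1} they cannot start beneath it. *)
Lemma okada_shrinks N H : okada N.+1 H -> exists2 H', okada N H' & grows N H' H.
Proof.
move=> okH; have ndH := okada_nodes okH.
case: (okH) => orH /degree_partP dH crH glH neH.
have [x xH Nx] : exists2 x, x \in H & N.+1 \in arc_nodes x.
  by apply: degree_arc; rewrite dH leqnn.
have defH : H = x |` (H `\ x) by rewrite fsetD1K.
set H0 := H `\ x in defH.
have xH0 : x \notin H0 by rewrite !inE eqxx.
have sub y : y \in H0 -> y \in H by rewrite inE => /andP[].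
have dH0 (k : nat) :
    (count_mem k (arc_nodes x) + degree H0 k)%N = (0 < k <= N.+1).
  by rewrite -dH -degreeU1 // -defH.
have nd0 y (k : nat) : y \in H0 -> k \in arc_nodes y -> 0 < k <= N.
  move=> yH0 ky; have := ndH _ _ (sub _ yH0) ky.
  suff : k != N.+1 by lia.
  apply: contraTneq (degree_gt0 yH0 ky) => -> {k ky}.
  (* x already accounts for the only occurrence of N+1 *)
  have := dH0 N.+1; rewrite leqnn /= -leqNgt => d1.
  have : 0 < count_mem N.+1 (arc_nodes x) by rewrite -has_count has_pred1.
  case: (count_mem _ _) d1 => // c [/eqP].
  by rewrite addn_eq0 => /andP[_ /eqP->].
clearbody H0.
have glx := glH _ xH.
have orx := orH _ xH.
case: x => [j b l|k l] in xH Nx defH xH0 dH0 glx orx *.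
- have /andP[j0 jN] : 0 < j <= N.+1 by apply: ndH xH _; exact: mem_head.
  have /andP[b0 bN1] : 0 < b <= N.+1.
    by apply: ndH xH _; rewrite !inE eqxx orbT.
  have bN : b = N.+1.
    by move: Nx orx; rewrite !inE /= => /orP[] /eqP; lia.
  subst b.
  have lH0 : halves_below l H0.
    move=> k m kH; have kH' := sub _ kH.
    have := crH _ _ kH' xH; have := neH _ _ xH kH'; rewrite /=.
    have := nd0 _ k kH; rewrite !inE eqxx => /(_ isT).
    have : k != j.
      apply/eqP => kj; subst k; have := degree_gt0 kH (mem_head j _).
      by have := dH0 j; rewrite /= eqxx; lia.
    by lia.
  exists (Half j l |` H0); last first.
    by rewrite [X in grows _ _ X]defH; exact: GrowsClose.
  have hH0 := halves_below_notin j lH0.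
  split.
  + by move=> y /in_fsetU1P[->//|/sub /orH].
  + apply/degree_partP => k; rewrite degreeU1 //.
    by have := dH0 k; rewrite /=; lia.
  + move=> y z /in_fsetU1P[->|yH] /in_fsetU1P[->|zH] //; last first.
    * exact: crH (sub _ yH) (sub _ zH).
    * by case: y yH.
    case: z zH => // c d m zH /=.
    have := crH _ _ (sub _ zH) xH; have := nd0 _ d zH.
    rewrite /= !inE eqxx orbT; lia.
  + move=> y /in_fsetU1P[->|/sub /glH //].
    move: glx; rewrite /good_label /=; have -> : minn j N.+1 = j by lia.
    by [].
  + move=> y z /in_fsetU1P[->|yH] /in_fsetU1P[->|zH] //=; last first.
    * exact: neH (sub _ yH) (sub _ zH).
    * case: y yH => [a b m|i m] yH /=; last first.
        have := crH _ _ (sub _ yH) xH; have := nd0 _ i yH; rewrite /= !inE eqxx.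
        by lia.
      have := neH _ _ (sub _ yH) xH; have := nd0 _ b yH.
      have := orH _ (sub _ yH); rewrite /= !inE eqxx orbT.
      by lia.
    * by case: z zH => // k m zH _; exact: lH0 zH.
    * by rewrite ltnn.
- have kN : k = N.+1 by move: Nx; rewrite !inE; lia.
  subst k.
  have lH0 : halves_below l H0.
    move=> k m kH; have := neH _ _ xH (sub _ kH); rewrite /=.
    have := nd0 _ k kH; rewrite !inE eqxx.
    by lia.
  exists H0; last by rewrite [X in grows _ _ X]defH; exact: GrowsOpen.
  split.
  + by move=> y /sub /orH.
  + apply/degree_partP => k.
    by have := dH0 k; rewrite /=; lia.
  + by move=> y z /sub yH /sub zH; exact: crH.
  + by move=> y /sub /glH.
  + by move=> y z /sub yH /sub zH; exact: neH.
Qed.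

(** When the half arc at j is closed by N+1, a half arc to the right of j would
    come to lie beneath the new full arc; the conditions on labels exclude this,
    since such a half arc is nested in the one at j and would have a larger
    label. Everything nested in {j, N+1} was already nested in the half arc
    at j. *)
Lemma okada_grows N H' H : okada N H' -> grows N H' H -> okada N.+1 H.
Proof.
move=> okH gr; have ndH := okada_nodes okH.
case: (okH) => orH /degree_partP dH crH glH neH.
case: gr => [l H0 lH0 gl|j l H0 lH0] in okH ndH orH dH crH glH neH *.
- have xH0 : Half N.+1 l \notin H0 by exact: halves_below_notin.
  split.
  + by move=> y /in_fsetU1P[->//|/orH].
  + by apply/degree_partP => k; rewrite degreeU1 // dH /=; lia.
  + move=> y z /in_fsetU1P[->|yH] /in_fsetU1P[->|zH] //; last exact: crH.
      case: z zH => // c d m zH /=.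
      have := ndH _ d zH; rewrite /= !inE eqxx orbT.
      by lia.
    by case: y yH.
  + by move=> y /in_fsetU1P[->//|/glH].
  + move=> y z /in_fsetU1P[->|yH] /in_fsetU1P[->|zH] //=; last exact: neH.
    * by rewrite ltnn.
    * by case: z zH => // k m zH _; exact: lH0 zH.
    case: y yH => [a b m|i m] yH /=; have := ndH _ _ yH (mem_head _ _); lia.
- have hH0 : Half j l \notin H0 by exact: halves_below_notin.
  have xH : Half j l \in Half j l |` H0 by rewrite fset1U1.
  have sub y : y \in H0 -> y \in Half j l |` H0.
    by move=> yH; apply/in_fsetU1P; right.
  have jN := ndH _ j xH (mem_head _ _).
  have fH0 : Full j N.+1 l \notin H0.
    apply/negP => /sub fH; have := ndH _ N.+1 fH.
    by rewrite !inE eqxx orbT ltnn andbF => /(_ isT).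
  split.
  + by move=> y /in_fsetU1P[->/=|/sub /orH //]; lia.
  + apply/degree_partP => k; rewrite degreeU1 //.
    by have := dH k; rewrite degreeU1 //=; lia.
  + move=> y z /in_fsetU1P[->|yH] /in_fsetU1P[->|zH] //=.
    * by lia.
    * case: z zH => // c d m zH.
      by have := ndH _ d (sub _ zH); rewrite /= !inE eqxx orbT; lia.
    * case: y yH => [a b m|k m] yH /=.
        by have := crH _ _ xH (sub _ yH); rewrite /=; lia.
      by have := neH _ _ (sub _ yH) xH; have := lH0 _ _ yH; rewrite /=; lia.
    * by have := crH _ _ (sub _ yH) (sub _ zH).
  + move=> y /in_fsetU1P[->|/sub /glH //].
    have := glH _ xH; rewrite /good_label /=.
    by have -> : minn j N.+1 = j by lia.
  + move=> y z /in_fsetU1P[->|yH] /in_fsetU1P[->|zH] //=.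
    * by lia.
    * case: z zH => [c d m|k m] zH; last by move=> _; exact: lH0 zH.
      by have := ndH _ d (sub _ zH); rewrite /= !inE eqxx orbT; lia.
    * case: y yH => [a b m|k m] yH //=.
      by have := neH _ _ (sub _ yH) xH; rewrite /=; lia.
    * exact: neH (sub _ yH) (sub _ zH).
Qed.

(** * Restriction *)

Lemma restrictP r H y :
  reflect (exists x, [/\ x \in H, min_node x <= r & y = cut_arc r x])
    (y \in restrict r H).
Proof.
rewrite /restrict; apply: (iffP (imfsetP _ _ _ _)).
  by case=> x /andP[xH xr] ->; exists x.
case=> x [xH xr ->].
by exists x => //; apply/andP.
Qed.

Lemma restrictU1 r x H : restrict r (x |` H) =
  if min_node x <= r then cut_arc r x |` restrict r H else restrict r H.
Proof.
case: ifP => xr; apply/fsetP => y.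
  apply/restrictP/in_fsetU1P => [[z [/in_fsetU1P[->|zH] zr ->]]|].
  - by left.
  - by right; apply/restrictP; exists z.
  case=> [->|/restrictP[z [zH zr ->]]].
    by exists x; rewrite fset1U1.
  by exists z; rewrite in_fset1U zH orbT.
apply/restrictP/restrictP => -[z [zH zr ->]].
  by move: zH zr => /in_fsetU1P[->|zH zr]; [rewrite xr | exists z].
by exists z; rewrite in_fset1U zH orbT.
Qed.

Lemma restrict_comp r N H : r <= N -> restrict r (restrict N H) = restrict r H.
Proof.
move=> rN; apply/fsetP => y; apply/restrictP/restrictP.
  case=> _ [/restrictP[x [xH xN ->]] xr ->]; exists x; split=> //.
    by case: x xN xr {xH} => [a b l|//] /=; case: (b <= N) => /=; lia.
  case: x xN xr {xH} => [a b l|//] /=; case: (leqP b N) => //= bN _ _.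
  by case: (leqP b r) => //; lia.
case=> x [xH xr ->]; exists (cut_arc N x); split=> //.
- by apply/restrictP; exists x; split=> //; lia.
- by case: x xr {xH} => [a b l|//] /=; case: (leqP b N) => //=; lia.
case: x xr {xH} => [a b l|//] /=; case: (leqP b N) => //= bN _.
by case: (leqP b r) => //; lia.
Qed.

Lemma restrict_id N H :
  (forall x k, x \in H -> k \in arc_nodes x -> k <= N) -> restrict N H = H.
Proof.
move=> nodes; have fixed x : x \in H -> min_node x <= N /\ cut_arc N x = x.
  move/nodes; case: x => [a b l|k l] /= kN.
    have aN : a <= N by apply: kN; rewrite mem_head.
    have bN : b <= N by apply: kN; rewrite !inE eqxx orbT.
    by rewrite bN; split=> //; lia.
  by split=> //; apply: kN; rewrite mem_head.
apply/fsetP => y; apply/restrictP/idP => [[x [xH _ ->]]|yH].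
  by have [_ ->] := fixed _ xH.
by have [yN yE] := fixed _ yH; exists y.
Qed.

Lemma okada_restrict_id N H : okada N H -> restrict N H = H.
Proof.
move=> okH; apply: restrict_id => x k xH kx.
by have := okada_nodes okH xH kx; lia.
Qed.

Lemma grows_restrict N H' H : okada N H' -> grows N H' H -> restrict N H = H'.
Proof.
move=> okH gr; have ndH := okada_nodes okH; have idH := okada_restrict_id okH.
case: gr => [l H0 _ _|j l H0 _] in ndH idH *.
  by rewrite restrictU1 /= ltnn.
have idH0 : restrict N H0 = H0.
  apply: restrict_id => x k xH kx; have := ndH x k _ kx.
  by rewrite in_fset1U xH orbT; lia.
have := ndH _ j (fset1U1 _ _) (mem_head _ _).
rewrite restrictU1 /= ltnn idH0 => jN.
by case: ifP => //; lia.
Qed.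

(** * Labels of the half arcs *)

Lemma PropLabP m (H : diagram) :
  reflect (exists k, Half k m \in H) (m \in PropLab H).
Proof.
rewrite /PropLab; apply: (iffP (imfsetP _ _ _ _)) => /= [[x]|[k kH]].
  by case: x => [a b l /andP[]|k l /andP[xH _] ->] //; exists k.
by exists (Half k m) => //; apply/andP.
Qed.

Lemma PropLab0 : PropLab fset0 = fset0.
Proof. by apply/fsetP => m; apply/PropLabP; case. Qed.

Lemma PropLab_half k l (H : diagram) :
  PropLab (Half k l |` H) = l |` PropLab H.
Proof.
apply/fsetP => m; rewrite in_fset1U.
apply/PropLabP/orP => [[i /in_fsetU1P[[_ ->]|iH]]|[/eqP->|/PropLabP[i iH]]].
- by left.
- by right; apply/PropLabP; exists i.
- by exists k; rewrite fset1U1.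
- by exists i; rewrite in_fset1U iH orbT.
Qed.

Lemma PropLab_full a b l (H : diagram) :
  PropLab (Full a b l |` H) = PropLab H.
Proof.
apply/fsetP => m; apply/PropLabP/PropLabP => -[i iH]; exists i.
  by case/in_fsetU1P: iH.
by rewrite in_fset1U iH orbT.
Qed.

Lemma PropLab_below l (H : diagram) :
  halves_below l H <-> {in PropLab H, forall m, m < l}.
Proof.
split=> [lH m /PropLabP[k /lH]|lH k m kH] //.
by apply: lH; apply/PropLabP; exists k.
Qed.

(** * One step of the construction *)

Lemma diag_step_open i l (A : {fset nat}) H : l \notin A ->
  diag_step i A (l |` A) H = Half i l |` H.
Proof.
move=> lA; rewrite /diag_step; case: pickP => [[m /= mB]|].
  by case/andP=> mA _; move: mB mA => /fset1UP[->|->].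
by move/(_ [` fset1U1 l A]); rewrite /= lA eqxx.
Qed.

Lemma diag_step_close i l (A : {fset nat}) H : l \notin A ->
  diag_step i (l |` A) A H = [fset close_arc i l x | x in H].
Proof.
move=> lA; rewrite /diag_step; case: pickP => [[m /= mA]|_].
  by rewrite in_fset1U mA orbT.
case: pickP => [[m /= mB] /eqP AE|/(_ [` fset1U1 l A])]; last first.
  by rewrite /= fsetU1K // eqxx.
suff -> : m = l by [].
apply/eqP; apply: contraNT lA => ml.
by rewrite AE !inE eq_sym ml eqxx.
Qed.

(** The closing rule acts on every half arc labelled l; here the one at j is
    alone, since the others have smaller labels. *)
Lemma close_arc_rightmost i j l (H0 : diagram) : halves_below l H0 ->
  [fset close_arc i l x | x in Half j l |` H0] = Full j i l |` H0.
Proof.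
move=> lH0; have fixed x : x \in H0 -> close_arc i l x = x.
  by case: x => [//|k m] /lH0 /=; case: eqP => // ->; rewrite ltnn.
apply/fsetP => y; apply/imfsetP/in_fsetU1P => /= [[x /in_fsetU1P[->|xH] ->]|].
- by left; rewrite /= eqxx.
- by right; rewrite fixed.
case=> [->|yH]; first by exists (Half j l); rewrite ?fset1U1 //= eqxx.
by exists y; rewrite ?fixed // in_fset1U yH orbT.
Qed.

Lemma grows_diag_step N H' H : grows N H' H ->
  diag_step N.+1 (PropLab H') (PropLab H) H' = H.
Proof.
case=> [l H0 lH0 _|j l H0 lH0]; have /PropLab_below lS := lH0;
  have lS' : l \notin PropLab H0 by (apply/negP => /lS; rewrite ltnn).
- by rewrite PropLab_half diag_step_open.
- by rewrite PropLab_half PropLab_full diag_step_close // close_arc_rightmost.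
Qed.

Lemma grows_cover N H' H : fibonacci_set N (PropLab H') -> grows N H' H ->
  yfs_cover (N, PropLab H') (N.+1, PropLab H).
Proof.
move=> fibH gr; rewrite /yfs_cover /YFS /= eqxx fibH /=.
case: gr fibH => [l H0 /PropLab_below lS gl|j l H0 /PropLab_below lS].
- rewrite PropLab_half fibonacci_setU1_max // => ->.
  move: gl => /and3P[/= -> -> ->] /=.
  by apply/orP; right; apply/drops_maxP; exists l.
- rewrite PropLab_half PropLab_full => /(fibonacci_setU1_drop lS) -> /=.
  by apply/orP; left; apply/drops_maxP; exists l.
Qed.

(** Upward covers give the label of a half arc to open at N+1. For downward
    covers the lost maximum l is the label of some half arc, to be closed; the
    other half arcs have labels at most l, and a second one labelled l is
    impossible, as of two half arcs one is nested in the other. *)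
Lemma cover_grows N H' D : okada N H' -> yfs_cover (N, PropLab H') D ->
  exists2 H, grows N H' H & D = (N.+1, PropLab H).
Proof.
case: D => M T okH /and4P[/= fibS fibT /eqP/= ME]; subst M.
rewrite orbC => /orP[] /drops_maxP.
  case=> l lS TE; exists (Half N.+1 l |` H'); last by rewrite PropLab_half TE.
  constructor; first exact/PropLab_below.
  move: fibT; rewrite /YFS /= TE fibonacci_setU1_max // => /and4P[_ lN l0 par].
  exact/and3P.
case=> l lT SE.
have /PropLabP[j jH] : l \in PropLab H' by rewrite SE fset1U1.
have H'E : H' = Half j l |` (H' `\ Half j l) by rewrite fsetD1K.
have lH0 : halves_below l (H' `\ Half j l).
  move=> k m; rewrite in_fsetD1 => /andP[neq kH].
  have : m \in PropLab H' by apply/PropLabP; exists k.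
  rewrite SE => /fset1UP[mE|/lT //]; subst m.
  case: okH => _ _ _ _ neH; have := neH _ _ jH kH; have := neH _ _ kH jH.
  rewrite /= ltnn; case: (ltngtP k j) => [_ _ /(_ isT)|_ /(_ isT)|kj] //.
  by rewrite kj eqxx in neq.
exists (Full j N.+1 l |` (H' `\ Half j l)).
  by rewrite [X in grows _ X _]H'E; exact: GrowsClose.
have lT' : l \notin T by apply/negP => /lT; rewrite ltnn.
rewrite PropLab_full -(fsetU1K lT') -SE [in LHS]H'E PropLab_half fsetU1K //.
by apply/negP => /PropLabP[k /lH0]; rewrite ltnn.
Qed.

(** * Chains and diagrams, one rank at a time *)

Lemma okada0 H : okada 0 H -> H = fset0.
Proof.
move=> okH; apply/fsetP => x; rewrite in_fset0; apply/negP => xH.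
have nodes k : k \notin arc_nodes x.
  by apply/negP => kx; have := okada_nodes okH xH kx; lia.
by case: x nodes {xH} => [a b l|k l] /(_ _) h; [have := h a | have := h k];
  rewrite /= mem_head.
Qed.

Lemma okada_fset0 : okada 0 fset0.
Proof. by split; rewrite ?big_nil // => x. Qed.

Lemma Chain_rcons N H : okada N.+1 H ->
  Chain N.+1 H = rcons (Chain N (restrict N H)) (N.+1, PropLab H).
Proof.
move=> okH.
have -> : Chain N (restrict N H) = Chain N H.
  apply/eq_in_map => i; rewrite mem_iota => iN.
  by rewrite restrict_comp //; lia.
rewrite /Chain -[X in iota 0 X]addn1 iotaD map_cat cats1.
by rewrite add0n (okada_restrict_id okH).
Qed.

Lemma last_Chain N H C : okada N H -> last C (Chain N H) = (N, PropLab H).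
Proof.
case: N => [|N] okH; last by rewrite Chain_rcons // last_rcons.
by rewrite /= okada_restrict_id.
Qed.

Lemma saturated_chain_rcons N C D : C != [::] ->
  saturated_chain N.+1 (rcons C D) =
  saturated_chain N C && yfs_cover (last (0, fset0) C) D.
Proof.
case: C => // C0 C _ /=; rewrite rcons_path last_rcons.
case: (C0 == _); last by [].
case: (path _ _ _) => //=.
case: (boolP (yfs_cover _ _)) => [/and4P[_ _ /eqP-> _]|_].
  by rewrite eqSS andbT.
by rewrite andbF.
Qed.

Lemma size_saturated_chain N C : saturated_chain N C -> size C = N.+1.
Proof.
elim/last_ind: C N => // C D IHC [|N] satC; last first.
  case: C => [|C0 C] in IHC satC *; first by case/and3P: satC => /eqP->.
  by move: satC; rewrite saturated_chain_rcons // size_rcons => /andP[/IHC->].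
case: C => [//|C0 C] in satC {IHC} *.
move: satC => /= /and3P[_]; rewrite rcons_path last_rcons => /andP[_].
by case/and4P => _ _ /eqP->.
Qed.

Lemma diag_upto_prefix C D i : i < size C ->
  diag_upto (rcons C D) i = diag_upto C i.
Proof.
elim: i => //= i IHi iC; rewrite !nth_rcons iC IHi; last exact: ltnW.
by rewrite ltnW.
Qed.

Lemma Diag_rcons N C D : size C = N.+1 ->
  Diag N.+1 (rcons C D) = diag_step N.+1 (last (0, fset0) C).2 D.2 (Diag N C).
Proof.
move=> sC; rewrite /Diag /= !nth_rcons sC ltnn eqxx leqnn.
by rewrite diag_upto_prefix ?sC // -nth_last sC.
Qed.

(** That the label set is a Fibonacci set is carried along in the induction,
    because the new label set is Fibonacci as soon as the old one is, which
    spares a count of the nodes to the left of each half arc. *)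
Lemma okada_Chain N H : okada N H ->
  [/\ fibonacci_set N (PropLab H), saturated_chain N (Chain N H)
    & Diag N (Chain N H) = H].
Proof.
elim: N H => [|N IHN] H okH.
  have H0 := okada0 okH; subst H.
  rewrite /Chain /= okada_restrict_id // PropLab0 /= eqxx; split=> //.
have [H' okH' gr] := okada_shrinks okH; have [fibH' satH' DH'] := IHN _ okH'.
have cov := grows_cover fibH' gr.
rewrite Chain_rcons // (grows_restrict okH' gr) saturated_chain_rcons //.
rewrite last_Chain // satH' cov Diag_rcons ?(size_saturated_chain satH') //.
rewrite DH' last_Chain // grows_diag_step //; split=> //.
by case/and4P: cov.
Qed.

Lemma saturated_chain_Diag N C : saturated_chain N C ->
  okada N (Diag N C) /\ Chain N (Diag N C) = C.
Proof.
elim: N C => [|N IHN] C satC; have sC := size_saturated_chain satC.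
  split; first exact: okada_fset0.
  rewrite /Chain /= okada_restrict_id; last exact: okada_fset0.
  rewrite PropLab0.
  by case: C satC sC => [//|C0 [|//]] /= /andP[/eqP-> _].
case/lastP: C => // C D in satC sC *.
have C_neq0 : C != [::] by case: C sC {satC}.
move: satC; rewrite saturated_chain_rcons // => /andP[satC cov].
have [okC CC] := IHN _ satC; have sC' := size_saturated_chain satC.
have lastC : last (0, fset0) C = (N, PropLab (Diag N C)).
  by rewrite -{1}CC last_Chain.
rewrite lastC in cov; have [H gr DE] := cover_grows okC cov.
have -> : Diag N.+1 (rcons C D) = H.
  by rewrite Diag_rcons // lastC DE /= grows_diag_step.
have okH := okada_grows okC gr; split=> //.
by rewrite Chain_rcons // (grows_restrict okC gr) CC DE.
Qed.

Theorem proposition4p13 (N : nat) :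
  [/\ forall H : diagram, okada N H -> saturated_chain N (Chain N H),
      forall C : seq ranked_set, saturated_chain N C -> okada N (Diag N C),
      forall H : diagram, okada N H -> Diag N (Chain N H) = H
    & forall C : seq ranked_set, saturated_chain N C -> Chain N (Diag N C) = C].
Proof.
by split=> [H /okada_Chain[]|C /saturated_chain_Diag[]|H /okada_Chain[]
  |C /saturated_chain_Diag[]].
Qed.
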